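(* Let $\mathcal{M}\subseteq\mathbb{R}^n$ be a $k$-manifold and let $\mathbf{g}:\mathbb{R}^n\to\mathcal{M}$ be infinitely differentiable (as a map into $\mathbb{R}^n$). If $\mathbf{x}\in\mathbb{R}^n$ satisfies $\operatorname{rank} J_{\mathbf{g}}(\mathbf{x})=k$, then there are open sets $\Omega,\Omega'\subseteq\mathbb{R}^n$ with $\mathbf{x}\in\Omega$ and $\mathbf{x}'=\mathbf{g}(\mathbf{x})\in\Omega'$ such that $\mathcal{M}\cap\Omega'=\mathbf{g}(\Omega)$.
   Context: $J_{\mathbf{g}}(\mathbf{x})=\left[\frac{\partial g_i}{\partial x_j}(\mathbf{x})\right]$ denotes the Jacobian matrix of $\mathbf{g}$ at $\mathbf{x}$, and $\mathbf{g}(\Omega)=\{\mathbf{g}(x)\mid x\in\Omega\}$. A subset $U\subseteq\mathbb{R}^n$ is said to be like $\mathbb{R}^k$ if there exist an open set $V\subseteq\mathbb{R}^k$ and an infinitely differentiable one-to-one mapping $\phi:V\to U$ (a bijection of $V$ onto $U$) whose inverse $\phi^{-1}:U\to V$ can be extended to an infinitely differentiable mapping $\psi:S\to\mathbb{R}^k$ on an open superset $S\supseteq U$ in $\mathbb{R}^n$, i.e. $\phi^{-1}(x)=\psi(x)$ for $x\in U$. A subset $\mathcal{M}\subseteq\mathbb{R}^n$ is called a $k$-dimensional manifold (or $k$-manifold) if every point $p\in\mathcal{M}$ has an open neighborhood $U\subseteq\mathbb{R}^n$ such that $U\cap\mathcal{M}$ is like $\mathbb{R}^k$. *)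

(* Defs.v *)
(* Points of R^n are row vectors 'rV[R]_n with the library
   (sup-norm) topology; every dimension, including 0, is allowed. *)
From HB Require Import structures.
From mathcomp Require Export all_boot all_order all_algebra.
From mathcomp Require Export all_classical all_reals all_analysis.
Export Order.TTheory GRing.Theory Num.Theory.
Export numFieldNormedType.Exports.

Set Implicit Arguments.
Unset Strict Implicit.
Unset Printing Implicit Defensive.

Local Open Scope classical_set_scope.
Local Open Scope ring_scope.

Definition iter_partial (R : realType) (n m : nat) (s : seq 'I_n)
    (f : 'rV[R]_n -> 'rV[R]_m) : 'rV[R]_n -> 'rV[R]_m :=
  foldr (fun i h => 'D_(delta_mx 0 i) h) f s.

(* Used only for open A, where iterated partial derivatives at points of A do
   not depend on the values of f outside A; so a map with domain A is
   represented by any of its extensions to the whole space. Differentiability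
   of all iterated partials includes their existence and continuity. *)
Definition smooth_on (R : realType) (n m : nat) (A : set 'rV[R]_n)
    (f : 'rV[R]_n -> 'rV[R]_m) : Prop :=
  forall (s : seq 'I_n) (x : 'rV[R]_n), A x ->
    differentiable (iter_partial s f) x.

(* The cancellation condition says that psi extends the inverse U -> V of
   phi. *)
Definition like_Rk (R : realType) (n k : nat) (U : set 'rV[R]_n) : Prop :=
  exists (V : set 'rV[R]_k) (phi : 'rV[R]_k -> 'rV[R]_n),
    [/\ open V, smooth_on V phi, set_bij V U phi &
      exists (S : set 'rV[R]_n) (psi : 'rV[R]_n -> 'rV[R]_k),
        [/\ open S, U `<=` S, smooth_on S psi & {in V, cancel phi psi}]].

Definition is_manifold (R : realType) (n k : nat) (M : set 'rV[R]_n) : Prop :=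
  forall p : 'rV[R]_n, M p ->
    exists U : set 'rV[R]_n, [/\ open U, U p & like_Rk k (U `&` M)].

(* The library's 'J acts on row vectors on the right, so its (j, i) entry is
   the j-th partial derivative of the i-th component of g. *)
Definition jacobian_matrix (R : realType) (n m : nat)
    (g : 'rV[R]_n -> 'rV[R]_m) (x : 'rV[R]_n) : 'M[R]_(m, n) :=
  ('J g x)^T.

(* Main.v *)
(* In a chart phi of M around g x, with smooth left inverse psi, write
   g = phi \o h near x, where h = psi \o g takes values in R^k. The chain rule
   gives k = rank (J g x) <= rank (J h x), so h is a submersion at x and maps
   neighbourhoods of x onto neighbourhoods of h x. If W is an open
   neighbourhood of h x made of such values, then Omega' = U n S n psi^-1(W)
   and Omega = g^-1(Omega') work: a point z of M in Omega' has
   psi z = h y for some y with g y in U, whence z = phi (psi z) = g y. *)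
Require Import Defs.
From HB Require Import structures.
From mathcomp Require Import ring lra.

Set Implicit Arguments.
Unset Strict Implicit.
Unset Printing Implicit Defensive.

Local Open Scope classical_set_scope.
Local Open Scope ring_scope.

(** * Completeness, norm estimates and entrywise convergence for matrices *)

HB.instance Definition _ (R : realType) (m n : nat) :=
  Complete.on 'M[R]_(m, n).

Lemma row_norm_le (R : realType) (n : nat) (v : 'rV[R]_n) (e : R) :
  0 <= e -> (forall j, `|v 0 j| <= e) -> `|v| <= e.
Proof.
move=> e0 ve.
rewrite [leLHS]/Num.Def.normr/= mx_normrE (bigmax_le _ e0)//= => -[i j] _ /=.
by rewrite ord1.
Qed.

Lemma entry_le_norm (R : realType) (m n : nat) (A : 'M[R]_(m, n)) i j :
  `|A i j| <= `|A|.
Proof.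
rewrite [leRHS]/Num.Def.normr/= mx_normrE.
exact: (le_bigmax _ _ (i, j)).
Qed.

Lemma norm_mulmx_le (R : realType) (n m : nat) (v : 'rV[R]_n)
    (A : 'M[R]_(n, m)) : `|v *m A| <= n%:R * `|A| * `|v|.
Proof.
apply/row_norm_le => [|j]; first by rewrite !mulr_ge0.
rewrite mxE (le_trans (ler_norm_sum _ _ _))//.
rewrite -mulrA mulr_natl -[X in _ *+ X]card_ord -sumr_const.
apply: ler_sum => i _; rewrite normrM mulrC.
by rewrite ler_pM// entry_le_norm.
Qed.

Lemma cvg_mx_entries (R : realType) (T : Type) (F : set_system T) (m n : nat)
    (f : T -> 'M[R]_(m, n)) (A : 'M[R]_(m, n)) : Filter F ->
  (forall i j, f t i j @[t --> F] --> A i j) -> f t @[t --> F] --> A.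
Proof.
move=> FF fA; apply/cvgrPdist_le => /= e e0; near=> t.
rewrite [leLHS]/Num.Def.normr/= mx_normrE (bigmax_le _ (ltW e0))//=.
move=> -[i j] _ /=; rewrite !mxE; move: (i) (j); near: t.
apply: filter_forall => {}i; apply: filter_forall => {}j.
by move/cvgrPdist_le : (fA i j); exact.
Unshelve. all: by end_near. Qed.

(** * Jacobians: chain rule and continuity *)

Lemma jacobian_eqP (R : realType) (n m : nat) (f : 'rV[R]_n -> 'rV[R]_m) x
    (A : 'M[R]_(n, m)) : differentiable f x ->
  (forall v, 'D_v f x = v *m A) -> 'J f x = A.
Proof.
by move=> df fA; apply/row_matrixP => i; rewrite !rowE -deriveEjacobian.
Qed.

Lemma jacobian_comp (R : realType) (n m p : nat) (f : 'rV[R]_n -> 'rV[R]_m)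
    (g : 'rV[R]_m -> 'rV[R]_p) x :
  differentiable f x -> differentiable g (f x) ->
  'J (g \o f) x = 'J f x *m 'J g (f x).
Proof.
move=> df dg; have dgf := differentiable_comp df dg.
apply: jacobian_eqP => // v.
rewrite mulmxA -(deriveEjacobian _ df) -(deriveEjacobian _ dg).
by rewrite !deriveE// diff_comp.
Qed.

Lemma smooth_on_differentiable (R : realType) (n m : nat) (A : set 'rV[R]_n)
    (f : 'rV[R]_n -> 'rV[R]_m) x : smooth_on A f -> A x -> differentiable f x.
Proof. by move=> sf; exact: sf [::] x. Qed.

(** Row [i] of the Jacobian is the partial derivative indexed by [[:: i]], which [smooth_on] makes
    differentiable, hence continuous. *)
Lemma smooth_on_continuous_jacobian (R : realType) (n m : nat)
    (A : set 'rV[R]_n) (f : 'rV[R]_n -> 'rV[R]_m) x :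
  open A -> smooth_on A f -> A x -> 'J f y @[y --> x] --> 'J f x.
Proof.
move=> oA sf Ax; apply: (@cvg_mx_entries _ _ (nbhs x)) => i j.
have JE y : A y -> 'D_(delta_mx 0 i) f y 0 j = 'J f y i j.
  move=> Ay; rewrite deriveEjacobian; last exact: smooth_on_differentiable Ay.
  by rewrite -rowE mxE.
have /differentiable_continuous cf := sf [:: i] x Ax.
have cfj : 'D_(delta_mx 0 i) f y 0 j @[y --> x] --> 'D_(delta_mx 0 i) f x 0 j.
  exact: (cvg_comp _ _ cf (@coord_continuous _ _ _ 0 j _)).
move: cfj; rewrite (JE x Ax); apply: cvg_trans; apply: near_eq_cvg.
by near=> y; apply: JE; near: y; exact: open_nbhs_nbhs.
Unshelve. all: by end_near. Qed.

(** * Strict differentiability *)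

(* Unlike differentiability at a single point, this is enough for the inverse
   function theorem. *)
Definition strictly_differentiable (R : realType) (n m : nat)
    (f : 'rV[R]_n -> 'rV[R]_m) (x : 'rV[R]_n) (A : 'M[R]_(n, m)) : Prop :=
  forall e : R, 0 < e -> \forall ab \near (x, x),
    `|f ab.2 - f ab.1 - (ab.2 - ab.1) *m A| <= e * `|ab.2 - ab.1|.

(** Serves the mean value theorem, which concerns real-valued functions: hence a single coordinate
    [j] along a line. *)
Lemma is_derive_line (R : realType) (n m : nat) (f : 'rV[R]_n -> 'rV[R]_m)
    (a v : 'rV[R]_n) (t : R) (j : 'I_m) : differentiable f (a + t *: v) ->
  is_derive t 1 (fun t => f (a + t *: v) 0 j) ((v *m 'J f (a + t *: v)) 0 j).
Proof.
move=> df; set l := fun t : R => a + t *: v.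
have dl : is_diff t l ( *:%R^~ v).
  by apply: is_diff_eq (is_diffD (is_diff_cst a t) (is_diff_scalel t v)) _;
    rewrite add0r.
have dfl : differentiable (f \o l) t by exact: differentiable_comp.
have derfl : derivable (f \o l) t 1 by exact: diff_derivable.
apply: DeriveDef; first by move/derivable_mxP : derfl; exact.
have := derive_mx derfl; move=> /matrixP/(_ 0 j); rewrite mxE => <-.
rewrite deriveE// diff_comp//= diff_val scale1r.
by rewrite -deriveE// deriveEjacobian.
Qed.

(** By the mean value theorem on the segment from [a] to [b], coordinate [j] of [f b - f a] is that
    of [(b - a) *m 'J f z] for some [z] on the segment, and ['J f z] is close to ['J f x]. The point
    [z] may depend on [j], since the sup norm is bounded coordinate by coordinate. *)
Lemma C1_strictly_differentiable (R : realType) (n m : nat)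
    (f : 'rV[R]_n -> 'rV[R]_m) (x : 'rV[R]_n) :
  (\forall y \near x, differentiable f y) ->
  'J f y @[y --> x] --> 'J f x -> strictly_differentiable f x ('J f x).
Proof.
(* [norm_mulmx_le] costs a factor [n]; dividing by [n.+1] absorbs it and also covers [n = 0]. *)
move=> df cJ e e0; pose e' := e / (n.+1%:R).
have e'0 : 0 < e' by rewrite divr_gt0.
have /nbhs_ballP[/= d d0 xd] : \forall y \near x,
    differentiable f y /\ `|'J f x - 'J f y| <= e'.
  near=> y; split; near: y => //.
  by move/cvgrPdist_le : cJ; exact.
apply/nbhs_ballP; exists d => //= -[a b] [/= xa xb].
apply/row_norm_le => [|j]; first by rewrite mulr_ge0// ltW.
have seg t : t \in `[0, 1] -> ball x d (a + t *: (b - a)).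
  rewrite in_itv/= => /andP[t0 t1]; move: xa xb; rewrite -!ball_normE /ball_/=.
  move=> xa xb.
  have -> : x - (a + t *: (b - a)) = (1 - t) *: (x - a) + t *: (x - b).
    by apply/rowP => i; rewrite !mxE; ring.
  rewrite (le_lt_trans (ler_normD _ _))// !normrZ !ger0_norm ?subr_ge0//.
  pose p := Num.max `|x - a| `|x - b|; have pd : p < d by rewrite gt_max xa.
  have pa : `|x - a| <= p by rewrite le_max lexx.
  have pb : `|x - b| <= p by rewrite le_max lexx orbT.
  have t1' : 0 <= 1 - t by rewrite subr_ge0.
  have := ler_wpM2l t0 pb; have := ler_wpM2l t1' pa; lra.
have [||c] := @MVT_segment R (fun t => f (a + t *: (b - a)) 0 j)
  (fun t => ((b - a) *m 'J f (a + t *: (b - a))) 0 j) 0 1 ler01.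
- move=> t /subset_itv_oo_cc/seg/xd[dft _]; exact: is_derive_line.
- apply: continuous_in_subspaceT => t; rewrite inE/= => /seg/xd[dft _].
  apply: differentiable_continuous; apply/derivable1_diffP.
  by case: (is_derive_line j dft).
move=> c01; rewrite subr0 mulr1 scale1r scale0r addr0 [a + _]addrC subrK => fE.
have [_ Jc] := xd _ (seg _ c01).
have -> : (f b - f a - (b - a) *m 'J f x) 0 j
    = - ((b - a) *m ('J f x - 'J f (a + c *: (b - a)))) 0 j.
  move: ('J f x) ('J f _) fE => A B fE.
  rewrite mulmxBr; move: (_ *m A) (_ *m B) fE => p q fE.
  by rewrite !mxE fE; ring.
rewrite normrN (le_trans (entry_le_norm _ _ _))//.
rewrite (le_trans (norm_mulmx_le _ _))// ler_wpM2r//.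
rewrite (@le_trans _ _ (n%:R * e'))// ?ler_wpM2l//.
by rewrite /e' mulrCA ger_pMr// ler_pdivrMr// mul1r ler_nat.
Unshelve. all: by end_near. Qed.

Lemma strictly_differentiable_lipschitz (R : realType) (n m : nat)
    (f : 'rV[R]_n -> 'rV[R]_m) x A : strictly_differentiable f x A ->
  \forall ab \near (x, x),
    `|f ab.2 - f ab.1| <= (n%:R * `|A| + 1) * `|ab.2 - ab.1|.
Proof.
move=> /(_ 1 ltr01); apply: filterS => -[a b] /= fab.
rewrite -(subrK ((b - a) *m A) (f b - f a)) (le_trans (ler_normD _ _))//.
by rewrite addrC mulrDl lerD// norm_mulmx_le.
Qed.

(** The error is that of [g] on the increment of [f], plus that of [f] multiplied by [B]; each gets
    half of [e]. *)
Lemma strictly_differentiable_comp (R : realType) (n m p : nat)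
    (f : 'rV[R]_n -> 'rV[R]_m) (g : 'rV[R]_m -> 'rV[R]_p) x A B :
  {for x, continuous f} ->
  strictly_differentiable f x A -> strictly_differentiable g (f x) B ->
  strictly_differentiable (g \o f) x (A *m B).
Proof.
move=> cf df dg e e0.
(* [K] is a Lipschitz constant of [f] near [x] and [L] bounds multiplication by [B]; the added 1 in
   [L] keeps it positive for the division. *)
pose K := n%:R * `|A| + 1; pose L := m%:R * `|B| + 1.
have K0 : 0 < K by rewrite ltr_wpDl// mulr_ge0.
have L0 : 0 < L by rewrite ltr_wpDl// mulr_ge0.
have cff : (f ab.1, f ab.2) @[ab --> (x, x)] --> (f x, f x).
  by apply: (cvg_pair (G := nbhs (f x)) (H := nbhs (f x)));
    [exact: (cvg_comp fst f (cvg_fst (F := nbhs x) (G := nbhs x)) cf)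
    |exact: (cvg_comp snd f (cvg_snd (F := nbhs x) (G := nbhs x)) cf)].
have e1 : 0 < e / 2 / K by rewrite !divr_gt0.
have e2 : 0 < e / 2 / L by rewrite !divr_gt0.
have lf := strictly_differentiable_lipschitz df.
near=> ab.
have gab : `|g (f ab.2) - g (f ab.1) - (f ab.2 - f ab.1) *m B|
    <= e / 2 / K * `|f ab.2 - f ab.1|.
  by near: ab; apply: cff (dg _ e1).
have fab : `|f ab.2 - f ab.1 - (ab.2 - ab.1) *m A| <= e / 2 / L * `|ab.2 - ab.1|.
  by near: ab; exact: df.
have fl : `|f ab.2 - f ab.1| <= K * `|ab.2 - ab.1| by near: ab.
have -> : (g \o f) ab.2 - (g \o f) ab.1 - (ab.2 - ab.1) *m (A *m B)
   = (g (f ab.2) - g (f ab.1) - (f ab.2 - f ab.1) *m B)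
     + (f ab.2 - f ab.1 - (ab.2 - ab.1) *m A) *m B.
  by rewrite (mulmxBl (f ab.2 - f ab.1)) -mulmxA addrA subrK.
rewrite (le_trans (ler_normD _ _))// [e in leRHS]splitr mulrDl lerD//.
  rewrite (le_trans gab)// (le_trans (ler_wpM2l (ltW e1) fl))//.
  by rewrite mulrA divfK// lt0r_neq0.
rewrite (le_trans (norm_mulmx_le _ _))//.
rewrite (@le_trans _ _ (L * (e / 2 / L * `|ab.2 - ab.1|)))//.
  by rewrite ler_pM ?mulr_ge0// /L lerDl.
by rewrite mulrA [L * _]mulrC divfK// lt0r_neq0.
Unshelve. all: by end_near. Qed.

(** * Local surjectivity *)

(* With B *m A = 1, a solution of h (x + t *m B) = y is a fixed point of
   t |-> t - (h (x + t *m B) - y), which strict differentiability makes a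
   1/2-contraction of a small closed ball. *)
Lemma strictly_differentiable_image_nbhs (R : realType) (n k : nat)
    (h : 'rV[R]_n -> 'rV[R]_k) x A (N : set 'rV[R]_n) :
  strictly_differentiable h x A -> row_full A -> nbhs x N ->
  nbhs (h x) (h @` N).
Proof.
move=> dh /row_fullP[B BA] Nx.
pose C := k%:R * `|B| + 1.
have C0 : 0 < C by rewrite ltr_wpDl// mulr_ge0.
have normB (t : 'rV_k) : `|t *m B| <= C * `|t|.
  by rewrite (le_trans (norm_mulmx_le _ _))// ler_wpM2r// /C lerDl.
(* With this error the contraction ratio is [(2 * C)^-1 * C], that is 1/2. *)
have e0 : 0 < (2 * C)^-1 by rewrite invr_gt0 mulr_gt0.
have /nbhs_ballP[/= d d0 xd] := dh _ e0.
have /nbhs_ballP[/= d' d'0 xd'] := Nx.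
(* Then [C * r] is below both [d] and [d'], so [x + t *m B] stays in both balls when [t] has norm at
   most [r]. *)
pose r := Num.min d d' / 2 / C.
have r0 : 0 < r by rewrite !divr_gt0// lt_min d0.
have rd (t : 'rV_k) :
      `|t| <= r -> ball x d (x + t *m B) /\ ball x d' (x + t *m B).
  move=> tr; rewrite -!ball_normE /ball_/=; apply/andP; rewrite -lt_min.
  rewrite opprD addrA subrr sub0r normrN (le_lt_trans (normB _))//.
  rewrite (@le_lt_trans _ _ (C * r)) ?(ler_wpM2l (ltW C0))//.
  rewrite /r [C * _]mulrC divfK ?lt0r_neq0//.
  by rewrite ltr_pdivrMr// ltr_pMr ?ltr1n// lt_min d0.
(* For [y] this close to [h x], [T 0] has norm at most [r / 2]; the contraction adds at most another
   [r / 2], so [T] preserves the ball of radius [r]. *)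
apply/nbhs_ballP; exists (r / 2) => [|y] /=; first by rewrite divr_gt0.
rewrite -ball_normE /ball_/= => hy.
pose U := [set t : 'rV[R]_k | `|t| <= r].
pose T t := t - (h (x + t *m B) - y).
(* Since [B *m A = 1], [T s - T t] is minus the linearization error of [h] between the two
   points. *)
have TB s t : U s -> U t -> `|T s - T t| <= 2^-1 * `|s - t|.
  move=> /rd[sd _] /rd[td _].
  have /= := xd (x + t *m B, x + s *m B) (conj td sd).
  rewrite opprD addrACA subrr add0r -mulmxBl -mulmxA BA mulmx1 => le1.
  have -> : T s - T t = - (h (x + s *m B) - h (x + t *m B) - (s - t)).
    by apply/rowP => i; rewrite !mxE; ring.
  rewrite normrN (le_trans le1)// (le_trans (ler_wpM2l (ltW e0) (normB _)))//.
  by rewrite mulrA invfM -[_^-1 * _^-1 * C]mulrA mulVf ?mulr1// lt0r_neq0.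
have T0 : `|T 0| <= r / 2.
  by rewrite /T mul0mx addr0 sub0r opprB distrC ltW.
have U0 : U 0 by rewrite /U/= normr0 ltW.
have TU : set_fun U U T.
  move=> t Ut; rewrite /U/= -(subrK (T 0) (T t)) (le_trans (ler_normD _ _))//.
  rewrite [leRHS]splitr lerD// (le_trans (TB _ _ Ut U0))// subr0 mulrC.
  by rewrite ler_wpM2r.
pose T' : {fun U >-> U} := mkfun_fun TU.
have [|||t Ut tT] := @banach_fixed_point R _ U T'.
- exists (2^-1)%:nng; split => /=; first by rewrite invf_lt1// ltr1n.
  by move=> [s t] [/= Us Ut]; exact: TB.
- rewrite (_ : U = closed_ball_ Num.norm 0 r); first exact: closed_closed_ball_.
  by apply/seteqP; split => t; rewrite /U/closed_ball_/= sub0r normrN.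
- by exists 0.
exists (x + t *m B); first by apply: xd'; exact: (rd _ Ut).2.
move/esym/eqP: tT; rewrite /= /T -subr_eq0 addrAC subrr add0r oppr_eq0.
by rewrite subr_eq0 => /eqP.
Unshelve. all: by end_near. Qed.

(** * Images of open sets in the manifold *)

Theorem theorem3 (R : realType) (n k : nat) (M : set 'rV[R]_n)
    (g : 'rV[R]_n -> 'rV[R]_n) (x : 'rV[R]_n)
    (manM : is_manifold k M)
    (gM : forall y, M (g y))
    (smooth_g : smooth_on [set: 'rV[R]_n] g)
    (rank_g : \rank (jacobian_matrix g x) = k) :
  exists Omega Omega' : set 'rV[R]_n,
    [/\ open Omega, open Omega', Omega x, Omega' (g x) &
        M `&` Omega' = g @` Omega].
Proof.
have [U [oU Ugx [V [phi [_ sphi [_ _ phis] [S [psi [oS US spsi phiK]]]]]]]]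
  := manM _ (gM x).
have dg y : differentiable g y by exact: smooth_on_differentiable smooth_g _.
have cg : continuous g by move=> y; exact: differentiable_continuous.
pose h := psi \o g.
have hP y : U (g y) -> V (h y) /\ phi (h y) = g y.
  move=> Ugy; have [v Vv vg] := phis _ (conj Ugy (gM y)).
  by rewrite /h/= -vg phiK ?inE.
have dpsi : differentiable psi (g x).
  by apply: (smooth_on_differentiable spsi); exact: US.
have dh : differentiable h x by exact: differentiable_comp.
have [Vhx _] := hP _ Ugx.
have dphi : differentiable phi (h x) by exact: smooth_on_differentiable Vhx.
(* [phi \o h] agrees with [g] only on the preimage of [U], a neighbourhood of [x], which suffices
   for derivatives. *)
have Jg : 'J g x = 'J h x *m 'J phi (h x).
  rewrite -(jacobian_comp dh dphi); apply: jacobian_eqP => // v.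
  rewrite -deriveEjacobian; last exact: differentiable_comp.
  apply: near_eq_derive; near=> y; apply/esym; apply: (hP _ _).2.
  by near: y; apply: cg; exact: open_nbhs_nbhs.
have fullh : row_full ('J h x).
  rewrite /row_full eqn_leq rank_leq_col/= -{1}rank_g mxrank_tr Jg.
  exact: mxrankM_maxl.
(* Composing at the level of strict differentiability avoids proving [psi \o g] smooth. *)
have sh : strictly_differentiable h x ('J h x).
  rewrite (jacobian_comp (dg x) dpsi); apply: strictly_differentiable_comp.
  - exact: cg.
  - apply: C1_strictly_differentiable; first by near=> y; exact: dg.
    by exact: (smooth_on_continuous_jacobian openT smooth_g).
  - apply: C1_strictly_differentiable.
      near=> z; apply: (smooth_on_differentiable spsi).
      by near: z; apply: open_nbhs_nbhs; split => //; exact: US.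
    by apply: (smooth_on_continuous_jacobian oS spsi); exact: US.
have UgN : nbhs x (g @^-1` U) by apply: cg; exact: open_nbhs_nbhs.
have := strictly_differentiable_image_nbhs sh fullh UgN.
rewrite nbhsE => -[W [oW Whx] WhU].
pose O' := [set z | [/\ U z, S z & W (psi z)]].
(* The preimage of [W] under [psi] need not be open by itself, as [psi] is controlled only on [S];
   intersecting with [S] repairs this. *)
have oO' : open O'.
  rewrite openE => z [Uz Sz Wz]; rewrite /interior.
  have cpsi : {for z, continuous psi}.
    exact/differentiable_continuous/(smooth_on_differentiable spsi).
  near=> w; split; near: w; [exact: open_nbhs_nbhs|exact: open_nbhs_nbhs|].
  by apply: cpsi; exact: open_nbhs_nbhs.
have O'gx : O' (g x) by split => //; exact: US.
exists (g @^-1` O'), O'; split => //; first exact: open_comp.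
apply/seteqP; split => [z [Mz [Uz Sz Wz]]|_ [y O'gy <-]]; last by split.
have [y Ugy hyz] := WhU _ Wz.
have [v Vv vz] := phis _ (conj Uz Mz).
have gyz : g y = z by rewrite -(hP _ Ugy).2 hyz -vz phiK ?inE.
by exists y => //=; rewrite gyz.
Unshelve. all: by end_near. Qed.
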